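(* Let $a_0,a_1>0$. Let $X_1,Y,B_1$ be three independent real random variables such that $X_1\sim\beta(a_1,a_0)$, $Y\sim\beta(1,a_0+a_1)$ and $B_1\sim\frac{a_0}{a_0+a_1}\delta_0+\frac{a_1}{a_0+a_1}\delta_1$. Then $$X_1\sim X_1(1-Y)+B_1Y .$$
   Context: The notation $U\sim V$ between random variables means equality in distribution, and $U\sim\mu$ means that $U$ has law $\mu$. For $p,q>0$, $\beta(p,q)$ is the law on $(0,1)$ with density $\frac{\Gamma(p+q)}{\Gamma(p)\Gamma(q)}x^{p-1}(1-x)^{q-1}$. $\delta_x$ is the Dirac mass at $x$. *)

(* Defs.v *)
From HB Require Import structures.
From mathcomp Require Import all_boot all_order all_algebra.
From mathcomp Require Import all_classical all_reals all_analysis measurable_realfun.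

Set Implicit Arguments.
Unset Strict Implicit.
Unset Printing Implicit Defensive.

Import Order.TTheory GRing.Theory Num.Theory.
Import numFieldNormedType.Exports.

Local Open Scope classical_set_scope.
Local Open Scope ring_scope.

(* Laws are compared on measurable sets only: the values of [pushforward] and
   of integrals on non-measurable sets carry no meaning. *)
Definition has_law d (T : measurableType d) (R : realType) (P : probability T R)
    (X : {RV P >-> R}) (mu : set R -> \bar R) : Prop :=
  forall A : set R, measurable A -> distribution P X A = mu A.

Definition eq_in_law d1 (T1 : measurableType d1) d2 (T2 : measurableType d2)
    (R : realType) (P1 : probability T1 R) (P2 : probability T2 R)
    (U : {RV P1 >-> R}) (V : {RV P2 >-> R}) : Prop :=
  forall A : set R, measurable A -> distribution P1 U A = distribution P2 V A.

(* Mutual independence; the product rules for two of the variables are the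
   instances where one of the sets is [setT]. *)
Definition independent3 d (T : measurableType d) (R : realType)
    (P : probability T R) (X Y Z : {RV P >-> R}) : Prop :=
  forall A B C : set R, measurable A -> measurable B -> measurable C ->
    P (X @^-1` A `&` Y @^-1` B `&` Z @^-1` C) =
    (P (X @^-1` A) * P (Y @^-1` B) * P (Z @^-1` C))%E.

(* Euler's integral, meaningful for [0 < p]. *)
Definition Gamma (R : realType) (p : R) : R :=
  \int[lebesgue_measure]_(x in `]0, +oo[) (x `^ (p - 1) * expR (- x)).

(* The library's [beta_pdf] and [beta_prob] only allow natural parameters. *)
Definition beta_density (R : realType) (p q x : R) : R :=
  Gamma (p + q) / (Gamma p * Gamma q) * x `^ (p - 1) * (1 - x) `^ (q - 1).

Definition beta_law (R : realType) (p q : R) (A : set R) : \bar R :=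
  (\int[lebesgue_measure]_(x in A `&` `]0%R, 1%R[) (beta_density p q x)%:E)%E.

(* Main.v *)
Require Import Defs.
From HB Require Import structures.
From mathcomp Require Import all_boot all_order all_algebra.
From mathcomp Require Import all_classical all_reals all_analysis measurable_realfun.
From mathcomp Require Import ring lra.

Set Implicit Arguments.
Unset Strict Implicit.
Unset Printing Implicit Defensive.

Import Order.TTheory GRing.Theory Num.Theory.
Import numFieldNormedType.Exports.

Local Open Scope classical_set_scope.
Local Open Scope ring_scope.

(* Let s = a0 + a1. Given B1 = 0, the right-hand side is X1 U with U = 1 - Y of
   density s u^(s-1); the substitution t = x u in the double integral cancels
   every power of u, and integrating (u - t)^(a0-1) over u in ]t, 1[ shows that
   X1 U has density (s / a0) (1 - t) f(t), where f is the density of X1. Given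
   B1 = 1, the same computation applies to 1 - (X1 U + Y) = (1 - X1) U with a0
   and a1 exchanged, and gives the density (s / a1) t f(t). The weights a0/s and
   a1/s of B1 make the sum (1 - t) f(t) + t f(t) = f(t). The normalizing
   constants are never computed: that of Y is s because its law has mass 1. *)

Local Notation lambda := lebesgue_measure.

(** * Affine changes of variables for Lebesgue measure *)

Lemma measurable_affine (R : realType) (a b : R) :
  measurable_fun [set: measurableTypeR R]
    (fun x => a * x + b : measurableTypeR R).
Proof. by apply: measurable_funD => //; exact: measurable_funM. Qed.

(** By uniqueness of Lebesgue measure it is enough to compare lengths on intervals []c, d]]. A
    negative [a] reverses the interval and moves its closed end to the left, whence the two
    cases. *)
Lemma lebesgue_measure_affine (R : realType) (a b : R)
    (A : set (measurableTypeR R)) : a != 0 -> measurable A ->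
  lambda A = (`|a|%:E * lambda ((fun x : R => (a * x + b)%R) @^-1` A))%E.
Proof.
move=> a0 mA.
pose phi (x : measurableTypeR R) : measurableTypeR R := a * x + b.
have := @lebesgue_measure_unique R
  (mscale (NngNum (normr_ge0 a)) (pushforward lambda phi)).
move=> /(_ (measurable_affine a b) _ A mA) -> // _ [[c d]] _ <-.
rewrite /= /mscale /= /pushforward /=.
case: (ltgtP a 0) a0 => // [an|ap] _.
  have -> : phi @^-1` `]c, d] = `[(d - b) / a, (c - b) / a[%classic.
    apply/seteqP; split => x /=; rewrite /phi !in_itv/= ler_ndivrMr// ltr_ndivlMr//;
    rewrite mulrC; lra.
  rewrite !lebesgue_measure_itv/= !lte_fin ltr_nM2r ?invr_lt0// ltrD2r.
  case: ifPn => _; last by rewrite mule0.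
  by rewrite ltr0_norm// -!EFinB -EFinM; congr EFin; field; rewrite lt_eqF.
have -> : phi @^-1` `]c, d] = `](c - b) / a, (d - b) / a]%classic.
  apply/seteqP; split => x /=; rewrite /phi !in_itv/= ler_pdivlMr// ltr_pdivrMr//;
  rewrite mulrC; lra.
rewrite !lebesgue_measure_itv/= !lte_fin ltr_pM2r ?invr_gt0// ltrD2r.
case: ifPn => _; last by rewrite mule0.
by rewrite gtr0_norm// -!EFinB -EFinM; congr EFin; field; rewrite gt_eqF.
Qed.

Lemma ge0_integral_affine (R : realType) (a b : R) (f : R -> \bar R) :
  a != 0 -> measurable_fun [set: R] f -> (forall x, 0 <= f x)%E ->
  (\int[lambda]_x f x = `|a|%:E * \int[lambda]_x f (a * x + b)%R)%E.
Proof.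
move=> a0 mf f0.
pose phi (x : measurableTypeR R) : measurableTypeR R := a * x + b.
rewrite -[X in (_ * X)%E]/(\int[lambda]_(x in phi @^-1` setT) (f \o phi) x)%E.
rewrite -ge0_integral_pushforward//; last exact: measurable_affine.
rewrite -[`|a|]/(NngNum (normr_ge0 a))%:num -ge0_integral_mscale//.
  exact: measurable_affine.
move=> mphi; apply: eq_measure_integral => /= A mA _.
exact: lebesgue_measure_affine.
Qed.

(** * Integration against a measure given by a density *)

Section integral_density.
Import HBNNSimple.

(** For indicators this is the hypothesis on [nu]. Linearity extends it to simple functions, and
    monotone convergence, applied on both sides to simple functions increasing to [h], gives the
    general case. *)
Lemma ge0_integral_density (R : realType) d (T : measurableType d)
    (m nu : {measure set T -> \bar R}) (f : T -> R) (h : T -> \bar R) :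
  measurable_fun [set: T] f -> (forall x, 0 <= f x) ->
  (forall A, measurable A -> nu A = \int[m]_(x in A) (f x)%:E)%E ->
  measurable_fun [set: T] h -> (forall x, 0 <= h x)%E ->
  (\int[nu]_x h x = \int[m]_x ((f x)%:E * h x))%E.
Proof.
move=> mf f0 nuE mh h0.
have mfE : measurable_fun setT (EFin \o f) by exact/measurable_EFinP.
pose g := nnsfun_approx measurableT mh.
have mg n : measurable_fun setT (EFin \o g n) by exact/measurable_EFinP.
have gh x : (EFin \o g n) x @[n --> \oo] --> h x.
  by apply: cvg_nnsfun_approx => // ? _; exact: h0.
have ndg x : {homo (fun n => (EFin \o g n) x) : a b / (a <= b)%N >-> (a <= b)%E}.
  by move=> a b ab /=; rewrite lee_fin; exact/lefP/nd_nnsfun_approx.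
transitivity (limn (fun n => \int[nu]_x (EFin \o g n) x))%E.
  rewrite -monotone_convergence//.
    by apply: eq_integral => x _; exact/esym/cvg_lim.
  by move=> n x _; rewrite lee_fin.
transitivity (limn (fun n => \int[m]_x ((f x)%:E * (EFin \o g n) x)))%E; last first.
  rewrite -monotone_convergence//.
  - apply: eq_integral => x _; apply/cvg_lim => //.
    exact: cvgeZl.
  - by move=> n; exact: emeasurable_funM.
  - by move=> n x _; rewrite mule_ge0// lee_fin.
  - by move=> x _ a b ab; apply: lee_wpmul2l; [rewrite lee_fin|exact: ndg].
apply: congr_lim; apply/funext => n.
(* Only the simple function [g n] remains; it is split into its level sets, so that the claim can be
   checked for one value [r] at a time. *)
transitivity (\sum_(r \in range (g n)) \int[nu]_x (r * \1_(g n @^-1` [set r]) x)%:E)%E.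
  rewrite -ge0_integral_fsum//.
  - by apply: eq_integral => x _; rewrite /= fsumEFin// -fimfunE.
  - by move=> r; exact/measurable_EFinP/measurable_funM.
  - by move=> r x _; rewrite EFinM nnfun_muleindic_ge0.
transitivity (\int[m]_x \sum_(r \in range (g n))
    ((f x)%:E * (r * \1_(g n @^-1` [set r]) x)%:E))%E; last first.
  apply: eq_integral => x _; rewrite -ge0_mule_fsumr => [|r]; last first.
    exact: nnfun_muleindic_ge0.
  by rewrite fsumEFin // -(fimfunE _ x).
rewrite ge0_integral_fsum//; last 2 first.
- move=> r; apply: emeasurable_funM => //; exact/measurable_EFinP/measurable_funM.
- by move=> r x _; rewrite EFinM mule_ge0 ?nnfun_muleindic_ge0 ?lee_fin.
apply: eq_fsbigr => r rg.
rewrite integralZl_indic_nnsfun// integral_indic// setIT nuE//.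
under [RHS]eq_integral do rewrite EFinM muleCA.
rewrite ge0_integralZl//.
- congr (_ * _)%E; rewrite integral_mkcond.
  by apply: eq_integral => x _; rewrite epatch_indic.
- apply: emeasurable_funM => //; exact/measurable_EFinP.
- by move=> x _; rewrite mule_ge0 ?lee_fin.
- by move: rg; rewrite inE => -[t _ <-]; rewrite lee_fin.
Qed.

End integral_density.

(** * Truncated powers *)

(* The cutoff makes the beta density p, q proportional to
   [pospow p x * pospow q (1 - x)] on the whole line. *)
Definition pospow (R : realType) (q x : R) : R := x `^ (q - 1) * (0 < x)%R%:R.

Lemma pospow_ge0 (R : realType) (q x : R) : 0 <= pospow q x.
Proof. by rewrite /pospow mulr_ge0// powR_ge0. Qed.

Lemma measurable_pospow (R : realType) (q : R) : measurable_fun [set: R] (pospow q).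
Proof.
apply: measurable_funM; first exact: measurable_powR.
rewrite (_ : (fun x => _) = \1_(`]0, +oo[%classic : set R)).
  exact: measurable_indic.
by apply/funext => x; rewrite indicE; congr (_%:R); rewrite mem_setE in_itv/= andbT.
Qed.

Lemma pospow_gt0E (R : realType) (q x : R) : 0 < x -> pospow q x = x `^ (q - 1).
Proof. by move=> x0; rewrite /pospow x0 mulr1. Qed.

Lemma pospow_le0E (R : realType) (q x : R) : x <= 0 -> pospow q x = 0.
Proof. by move=> x0; rewrite /pospow ltNge x0 mulr0. Qed.

(** For [x <= 0] both sides vanish by the cutoff. This identity finally turns the raised parameters
    into the factors [t] and [1 - t]. *)
Lemma pospow_succ (R : realType) (q x : R) : pospow (q + 1) x = pospow q x * x.
Proof.
have [x0|x0] := ltP 0 x; last by rewrite !pospow_le0E// mul0r.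
rewrite !pospow_gt0E// -[X in _ * X](powRr1 (ltW x0)) -powRD; last first.
  by rewrite (gt_eqF x0) implybT.
by congr powR; ring.
Qed.

Lemma pospowM (R : realType) (q x y : R) : 0 < y ->
  pospow q (x * y) = pospow q x * y `^ (q - 1).
Proof.
move=> y0; rewrite /pospow pmulr_lgt0// mulrAC.
have [x0|x0] := ltP 0 x; last by rewrite !mulr0.
by rewrite !mulr1 powRM ?ltW.
Qed.

(** * Integrals of truncated powers *)

(** Staying away from 0 keeps the integrand continuous even for [q < 1], so the fundamental theorem
    of calculus applies. *)
Lemma integral_powR_itv (R : realType) (q c e : R) : 0 < q -> 0 < e -> e < c ->
  (\int[lambda]_(x in `[e, c]) (x `^ (q - 1))%:E = ((c `^ q - e `^ q) / q)%:E)%E.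
Proof.
move=> q0 e0 ec.
have pos x : x \in `[e, c] -> 0 < x.
  by rewrite in_itv/= => /andP[+ _]; exact: lt_le_trans.
have dF (x : R) : 0 < x -> is_derive x 1 (fun x => q^-1 * x `^ q) (x `^ (q - 1)).
  move=> x0; have dpow := is_derive1_powR q x0.
  by apply: is_derive_eq; rewrite /GRing.scale/= mulKf// gt_eqF.
have cont (F : R -> R) : (forall x, 0 < x -> derivable F x 1) ->
    {within `[e, c], continuous F}.
  move=> dG; apply: derivable_within_continuous => x /pos; exact: dG.
rewrite (@continuous_FTC2 _ _ (fun x => q^-1 * x `^ q))//.
- by rewrite -EFinB; congr EFin; ring.
- by apply: cont => x x0; apply: derivable_powR; rewrite in_itv/= x0.
- have /(continuous_within_itvP _ ec)[_ Fe Fc] :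
    {within `[e, c], continuous (fun x => q^-1 * x `^ q)}.
    by apply: cont => x x0; exact: (@ex_derive _ _ _ _ _ _ _ (dF x x0)).
  split => // x /subset_itv_oo_cc/pos x0.
  exact: (@ex_derive _ _ _ _ _ _ _ (dF x x0)).
- move=> x /subset_itv_oo_cc/pos x0; rewrite derive1E.
  exact: (@derive_val _ _ _ _ _ _ _ (dF x x0)).
Qed.

(** The factor [pospow 1 (c - x)] is the indicator of [x < c], so for positive [c] this is the
    integral of a power over []0, c[], possibly singular at 0. It is obtained as a limit over
    compact intervals. The cutoff in [pospow (q + 1) c] covers [c <= 0]. *)
Lemma integral_pospow_cut (R : realType) (q c : R) : 0 < q ->
  (\int[lambda]_x (pospow q x * pospow 1 (c - x))%:E = (pospow (q + 1) c / q)%:E)%E.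
Proof.
move=> q0.
have [c0|c0] := leP c 0.
  rewrite pospow_le0E// mul0r integral0_eq// => x _.
  have [x0|x0] := leP x 0; first by rewrite pospow_le0E// mul0r.
  by rewrite [X in _ * X]pospow_le0E ?mulr0//; lra.
rewrite pospow_gt0E// addrK.
(* With [n.+2] the left end is strictly below [c] already for [n = 0], as [integral_powR_itv]
   requires. *)
pose F (n : nat) : set (measurableTypeR R) := `[c / n.+2%:R, c]%classic.
have e0 n : 0 < c / n.+2%:R by rewrite divr_gt0.
have FE : \bigcup_i F i = `]0, c]%classic.
  apply/seteqP; split => [x [n _]|x]; rewrite /F /= !in_itv/=.
    by move=> /andP[ex ->]; rewrite (lt_le_trans (e0 n)).
  (* If [n] is the integer part of [c / x], then [c / x < n + 1 < n + 2], hence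
     [c / (n + 2) <= x]. *)
  move=> /andP[x0 xc]; exists (Num.truncn (c / x)) => //=; rewrite in_itv/= xc andbT.
  rewrite ler_pdivrMr// -ler_pdivrMl// mulrC.
  by apply/ltW/(lt_trans (truncnS_gt _)); rewrite ltr_nat.
have lF : (\int[lambda]_(x in F n) (x `^ (q - 1))%:E @[n --> \oo]
    --> \int[lambda]_(x in \bigcup_i F i) (x `^ (q - 1))%:E)%E.
  apply: ge0_nondecreasing_set_cvg_integral.
  - apply/nondecreasing_seqP => n; rewrite subsetEset; apply: subset_itvr.
    by rewrite bnd_simp ler_pM2l// lef_pV2 ?posrE// ler_nat.
  - by move=> n; exact: measurable_itv.
  - by move=> n; apply/measurable_EFinP/measurable_funTS; exact: measurable_powR.
  - by move=> n x _; rewrite lee_fin powR_ge0.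
have lc : (((c `^ q - (c / n.+2%:R) `^ q) / q)%:E @[n --> \oo] --> (c `^ q / q)%:E)%E.
  apply: cvg_EFin; first exact: nearW.
  apply: cvgMl; rewrite -[X in _ --> X]subr0; apply: cvgB; first exact: cvg_cst.
  (* The lower endpoint contributes nothing in the limit: a positive power tends to 0 at 0 from the
     right. *)
  have /cvg_at_rightP := powR_cvg0 q0; apply; split; first exact: e0.
  rewrite -[X in _ --> X](mulr0 c); apply: cvgMr.
  have := @cvg_harmonic R; by rewrite -(cvg_shiftS (@harmonic R)).
transitivity (\int[lambda]_(x in `]0%R, c]) (x `^ (q - 1))%:E)%E; last first.
  rewrite -FE; apply: (cvg_unique _ lF) => //.
  apply: cvg_trans lc; apply: near_eq_cvg; apply: nearW => n /=.
  rewrite integral_powR_itv//.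
  by rewrite ltr_pdivrMr// ltr_pMr// ltr1n.
(* The end [c] is dropped, a null set, to match the strict cutoff [0 < c - x]. *)
rewrite -integral_itv_bndo_bndc; last first.
  by apply/measurable_EFinP/measurable_funTS; exact: measurable_powR.
rewrite [RHS]integral_mkcond; apply: eq_integral => x _ /=.
rewrite patchE mem_setE in_itv/=.
have [x0|x0] := ltP 0 x; last by rewrite pospow_le0E// mul0r.
have [xc|xc] := ltP x c; last by rewrite [X in _ * X]pospow_le0E ?mulr0//; lra.
by rewrite !pospow_gt0E ?subr_gt0// subrr powRr0 mulr1.
Qed.

(** * Multiplying a beta density by an independent factor [u] *)

Lemma measurable_fun_pospow d (T : measurableType d) (R : realType)
    (q : R) (f : T -> R) :
  measurable_fun [set: T] f -> measurable_fun [set: T] (fun x => pospow q (f x)).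
Proof. by move=> mf; apply: (measurableT_comp (measurable_pospow q)). Qed.

Lemma measurable_fun_indic d (T : measurableType d) (R : realType)
    (A : set R) (f : T -> R) :
  measurable A -> measurable_fun [set: T] f ->
  measurable_fun [set: T] (fun x => \1_A (f x) : R).
Proof. by move=> mA mf; apply: (measurableT_comp (measurable_indic _)). Qed.

Lemma measurable_pospow_onem (R : realType) (p q : R) :
  measurable_fun [set: R] (fun x => pospow p x * pospow q (1 - x)).
Proof.
apply: measurable_funM; first exact: measurable_pospow.
by apply: measurable_fun_pospow; exact: measurable_funB.
Qed.

(** Substituting [x = t / u] produces the Jacobian [1 / u] and, from the two densities, the powers
    [1 - p] and [1 - q] of [u]. Their product is exactly the inverse of the prefactor. *)
Lemma integral_pospow_dilation (R : realType) (p q u : R) (A : set R) : 0 < u ->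
  measurable A ->
  ((u `^ (p + q - 1))%:E *
     \int[lambda]_x (pospow p x * pospow q (1 - x) * \1_A (x * u))%:E
   = \int[lambda]_t (pospow p t * pospow q (u - t) * \1_A t)%:E)%E.
Proof.
move=> u0 mA.
have u'0 : u != 0 by rewrite gt_eqF.
rewrite (@ge0_integral_affine _ u^-1 0); first last.
- by move=> x; rewrite lee_fin !mulr_ge0 ?powR_ge0 ?indicE ?ler0n.
- apply/measurable_EFinP; apply: measurable_funM; first apply: measurable_funM.
  + exact: measurable_pospow.
  + by apply: measurable_fun_pospow; exact: measurable_funB.
  + by apply: measurable_fun_indic => //; exact: measurable_funM.
- by rewrite invr_eq0.
rewrite muleA -EFinM -ge0_integralZl//; first last.
- by rewrite lee_fin mulr_ge0 ?powR_ge0.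
- by move=> x _; rewrite lee_fin !mulr_ge0 ?powR_ge0 ?indicE ?ler0n.
- apply/measurable_EFinP; apply: measurable_funM; first apply: measurable_funM.
  + apply: measurable_fun_pospow; exact: measurable_funD.
  + apply: measurable_fun_pospow.
    apply: measurable_funB => //; exact: measurable_funD.
  + apply: measurable_fun_indic => //.
    apply: measurable_funM => //; exact: measurable_funD.
apply: eq_integral => t _; rewrite -EFinM addr0 [u^-1 * t]mulrC mulfVK//.
have -> : 1 - t / u = (u - t) / u by field.
have powV r : u^-1 `^ r = (u `^ r)^-1.
  by rewrite -(powR_inv1 (ltW u0)) -powRrM mulN1r powRN.
rewrite !pospowM ?invr_gt0// !powV ger0_norm ?invr_ge0 ?ltW//.
have -> : u `^ (p + q - 1) = u * (u `^ (p - 1) * u `^ (q - 1)).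
  rewrite -powRD ?u'0 ?implybT// -{2}(powRr1 (ltW u0)) -powRD ?u'0 ?implybT//.
  by congr powR; ring.
congr EFin; field.
by rewrite u'0 !powR_eq0 (negbTE u'0).
Qed.

(** After the dilation [t = x u], Tonelli's theorem lets [u] be integrated first, over []t, 1[];
    this yields the power [q] of [1 - t] divided by [q]. *)
Lemma integral_pospow_mul (R : realType) (p q : R) (A : set R) : 0 < q ->
  measurable A ->
  (\int[lambda]_u ((pospow (p + q) u * pospow 1 (1 - u))%:E *
     \int[lambda]_x (pospow p x * pospow q (1 - x) * \1_A (x * u))%:E)
   = \int[lambda]_t (q^-1 * (pospow p t * pospow (q + 1) (1 - t) * \1_A t))%:E)%E.
Proof.
move=> q0 mA.
(* The integrand in [(u, t)] after the substitution; the factor [pospow (p + q) u] has been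
   absorbed. *)
pose k (z : measurableTypeR R * measurableTypeR R) : \bar R :=
  (pospow 1 (1 - z.1) * (pospow p z.2 * pospow q (z.1 - z.2) * \1_A z.2))%:E.
have mfst : measurable_fun [set: measurableTypeR R * measurableTypeR R] fst.
  exact: measurable_fst.
have msnd : measurable_fun [set: measurableTypeR R * measurableTypeR R] snd.
  exact: measurable_snd.
have mk : measurable_fun setT k.
  apply/measurable_EFinP; apply: measurable_funM.
    apply: measurable_fun_pospow; exact: measurable_funB.
  apply: measurable_funM; first apply: measurable_funM.
  - exact: measurable_fun_pospow.
  - by apply: measurable_fun_pospow; exact: measurable_funB.
  - exact: measurable_fun_indic.
have k0 z : (0 <= k z)%E by rewrite lee_fin !mulr_ge0 ?powR_ge0 ?indicE ?ler0n.
transitivity (\int[lambda]_u \int[lambda]_t k (u, t))%E.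
  apply: eq_integral => u _; have [u0|u0] := ltP 0 u.
    rewrite pospow_gt0E// mulrC EFinM -muleA integral_pospow_dilation//.
    rewrite -ge0_integralZl//.
    - apply/measurable_EFinP; apply: measurable_funM; first apply: measurable_funM.
      + exact: measurable_pospow.
      + by apply: measurable_fun_pospow; exact: measurable_funB.
      + exact: measurable_indic.
    - by move=> x _; rewrite lee_fin !mulr_ge0 ?powR_ge0 ?indicE ?ler0n.
    - by rewrite lee_fin pospow_ge0.
  (* For [u <= 0] the kernel vanishes too, since [0 < t] and [0 < u - t] are incompatible. *)
  rewrite pospow_le0E// mul0r mul0e integral0_eq// => t _; rewrite /k/=.
  have [t0|t0] := leP t 0; first by rewrite [pospow p t]pospow_le0E// !mul0r mulr0.
  by rewrite [pospow q _]pospow_le0E ?mulr0 ?mul0r ?mulr0//; lra.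
rewrite (fubini_tonelli k)//; apply: eq_integral => t _; rewrite /k/=.
transitivity ((pospow p t * \1_A t)%:E *
    \int[lambda]_u (pospow q (u - t) * pospow 1 (1 - u))%:E)%E.
  rewrite -ge0_integralZl//.
  - by apply: eq_integral => u _; rewrite -EFinM; congr EFin; ring.
  - apply/measurable_EFinP; apply: measurable_funM;
      by apply: measurable_fun_pospow; exact: measurable_funB.
  - by move=> x _; rewrite lee_fin !mulr_ge0 ?powR_ge0 ?indicE ?ler0n.
  - by rewrite lee_fin !mulr_ge0 ?powR_ge0 ?indicE ?ler0n.
(* The shift [u = v + t] brings the inner integral to the form of [integral_pospow_cut] with
   [c = 1 - t]. *)
rewrite (@ge0_integral_affine _ 1 t); first last.
- by move=> x; rewrite lee_fin !mulr_ge0 ?powR_ge0 ?indicE ?ler0n.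
- apply/measurable_EFinP; apply: measurable_funM;
    by apply: measurable_fun_pospow; exact: measurable_funB.
- exact: oner_neq0.
rewrite normr1 mul1e.
transitivity ((pospow p t * \1_A t)%:E *
    \int[lambda]_v (pospow q v * pospow 1 (1 - t - v))%:E)%E.
  congr (_ * _)%E; apply: eq_integral => v _; rewrite mul1r addrK.
  by have -> : 1 - (v + t) = 1 - t - v by ring.
by rewrite integral_pospow_cut// -EFinM; congr EFin; ring.
Qed.

(** * From laws of random variables to Lebesgue integrals *)

(** As functions of [M], both sides are measures that agree on rectangles by the independence
    hypothesis, so uniqueness of the product measure applies. The event [E] will be a value of the
    Bernoulli variable. *)
Lemma pair_law d (T : measurableType d) (R : realType) (P : probability T R)
    (U V : {RV P >-> R}) (E : set T) (M : set (R * R)) :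
  measurable E -> measurable M ->
  (forall A B : set R, measurable A -> measurable B ->
     P (U @^-1` A `&` V @^-1` B `&` E) = (P (U @^-1` A) * P (V @^-1` B) * P E)%E) ->
  P ((fun t => (U t, V t)) @^-1` M `&` E) =
  (P E * \int[distribution P U]_x \int[distribution P V]_y (\1_M (x, y))%:E)%E.
Proof.
move=> mE mM indep.
pose UV t : R * R := (U t, V t).
have mUV : measurable_fun setT UV by apply: measurable_fun_pair; exact: measurable_funP.
pose r : {nonneg R} := NngNum (fine_ge0 (measure_ge0 P E)).
have rE : r%:num%:E = P E by rewrite fineK// fin_num_measure.
have := @product_measure_unique _ _ R R R
  (mscale r (distribution P U)) (distribution P V) (pushforward (mrestr P mE) UV).
move=> /(_ mUV) H.
rewrite -[LHS]/(pushforward (mrestr P mE) UV M) -H//; last first.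
  by move=> A B mA mB; rewrite [LHS](indep A B mA mB) -rE muleC muleA.
rewrite /product_measure1 ge0_integral_mscale//; last first.
  exact: measurable_fun_xsection.
rewrite rE; congr (_ * _)%E; apply: eq_integral => x _.
have mS := measurable_xsection x mM.
rewrite /= -[xsection M x]setIT -integral_indic//.
apply: eq_integral => y _; congr EFin; rewrite !indicE; congr (_%:R).
by rewrite mem_xsection.
Qed.

Lemma beta_lawE (R : realType) (p q : R) (A : set R) :
  beta_law p q A =
  (\int[lambda]_(x in A) (Gamma (p + q) / (Gamma p * Gamma q) *
    (pospow p x * pospow q (1 - x)))%:E)%E.
Proof.
rewrite /beta_law integral_mkcondr; apply: eq_integral => x _.
rewrite patchE mem_setE in_itv/= /beta_density.
have [x0|x0] := ltP 0 x; last by rewrite pospow_le0E// mul0r mulr0.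
have [x1|x1] := ltP x 1; last by rewrite [pospow q _]pospow_le0E ?mulr0//; lra.
by rewrite !pospow_gt0E ?subr_gt0// mulrA.
Qed.

Lemma Gamma_ge0 (R : realType) (p : R) : 0 <= Gamma p.
Proof.
by apply: Rintegral_ge0 => x _; rewrite mulr_ge0 ?powR_ge0 ?expR_ge0.
Qed.

Lemma integral_beta_distribution d (T : measurableType d) (R : realType)
    (P : probability T R) (U : {RV P >-> R}) (p q : R) (h : R -> \bar R) :
  has_law U (beta_law p q) -> measurable_fun [set: R] h -> (forall x, 0 <= h x)%E ->
  (\int[distribution P U]_x h x =
   (Gamma (p + q) / (Gamma p * Gamma q))%:E *
   \int[lambda]_x ((pospow p x * pospow q (1 - x))%:E * h x))%E.
Proof.
move=> lawU mh h0.
have c0 : 0 <= Gamma (p + q) / (Gamma p * Gamma q).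
  by rewrite divr_ge0 ?mulr_ge0 ?Gamma_ge0.
have mb := measurable_pospow_onem p q.
have b0 x : 0 <= pospow p x * pospow q (1 - x) by rewrite mulr_ge0 ?pospow_ge0.
transitivity (\int[lambda]_x ((Gamma (p + q) / (Gamma p * Gamma q) *
    (pospow p x * pospow q (1 - x)))%:E * h x))%E.
  (* [lebesgue_measure] lives on [measurableTypeR R], whose display is not that
     of [R], so the law of U is transported there. *)
  pose U' (t : T) : measurableTypeR R := U t.
  have mU' : measurable_fun setT U' by exact: (measurable_funP U).
  transitivity (\int[pushforward P U']_x h x)%E.
    by rewrite ge0_integral_pushforward// [RHS]ge0_integral_pushforward.
  apply: ge0_integral_density => //.
  - exact: measurable_funM.
  - by move=> x; rewrite mulr_ge0.
  - by move=> A mA; rewrite -beta_lawE; exact: lawU.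
rewrite -ge0_integralZl//.
- by apply: eq_integral => x _; rewrite EFinM muleA.
- by apply: emeasurable_funM => //; exact/measurable_EFinP.
- by move=> x _; rewrite mule_ge0 ?lee_fin.
Qed.

Lemma ge0_integral_onem (R : realType) (f : R -> \bar R) :
  measurable_fun [set: R] f -> (forall x, 0 <= f x)%E ->
  (\int[lambda]_x f x = \int[lambda]_x f (1 - x)%R)%E.
Proof.
have N1 : (-1 : R) != 0 by rewrite oppr_eq0 oner_neq0.
move=> mf f0; rewrite (ge0_integral_affine 1 N1)//.
rewrite normrN1 mul1e; apply: eq_integral => x _.
by rewrite mulN1r addrC.
Qed.

(** Both laws are replaced by their densities, and the outer variable by [u = 1 - y]; this brings
    the double integral to the shape treated by [integral_pospow_mul]. *)
Lemma pair_beta_integral d (T : measurableType d) (R : realType)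
    (P : probability T R) (X Y : {RV P >-> R}) (p q s : R) (M : set (R * R)) :
  measurable M -> has_law X (beta_law p q) -> has_law Y (beta_law 1 s) ->
  (\int[distribution P Y]_y \int[distribution P X]_x (\1_M (y, x))%:E =
   (Gamma (1 + s) / (Gamma 1 * Gamma s) * (Gamma (p + q) / (Gamma p * Gamma q)))%:E *
   \int[lambda]_u ((pospow s u * pospow 1 (1 - u))%:E *
     \int[lambda]_x (pospow p x * pospow q (1 - x) * \1_M ((1 - u)%R, x))%:E))%E.
Proof.
move=> mM lawX lawY.
have mI : measurable_fun setT (fun z : R * R => (\1_M z)%:E : \bar R).
  by apply/measurable_EFinP; exact: measurable_indic.
have I0 z : (0 <= (\1_M z)%:E :> \bar R)%E by rewrite lee_fin indicE ler0n.
have mF : measurable_fun [set: R]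
    (fun y => \int[distribution P X]_x (\1_M (y, x))%:E)%E.
  exact: (@measurable_fun_fubini_tonelli_F _ _ _ _ _ (distribution P X) _ mI I0).
have F0 y : (0 <= \int[distribution P X]_x (\1_M (y, x))%:E)%E.
  exact: integral_ge0.
set cY := Gamma (1 + s) / _; set cX := Gamma (p + q) / _.
have mb := @measurable_pospow_onem R.
rewrite (integral_beta_distribution lawY mF F0) -/cY.
rewrite ge0_integral_onem; first last.
- by move=> y; rewrite mule_ge0// lee_fin mulr_ge0 ?pospow_ge0.
- by apply: emeasurable_funM => //; exact/measurable_EFinP.
have c0 : 0 <= cX by rewrite divr_ge0 ?mulr_ge0 ?Gamma_ge0.
rewrite [(cY * cX)%:E]EFinM -muleA; congr (_ * _)%E.
have mxs (y : R) : measurable_fun setT (fun x : R => \1_M (y, x) : R).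
  by apply: (measurableT_comp (measurable_indic mM)); exact: measurable_pair1.
have H y : (\int[distribution P X]_x (\1_M (y, x))%:E =
    cX%:E * \int[lambda]_x (pospow p x * pospow q (1 - x) * \1_M (y, x))%:E)%E.
  have mE : measurable_fun [set: R] (fun x => (\1_M (y, x))%:E : \bar R).
    exact/measurable_EFinP.
  rewrite (integral_beta_distribution lawX mE (fun x => I0 (y, x))) -/cX.
  by congr (_ * _)%E; apply: eq_integral => x _; rewrite EFinM.
have mG : measurable_fun [set: R] (fun y =>
    \int[lambda]_x (pospow p x * pospow q (1 - x) * \1_M (y, x))%:E)%E.
  pose g (z : measurableTypeR R * measurableTypeR R) :=
    (pospow p z.2 * pospow q (1 - z.2) * \1_M z)%:E.
  have mg : measurable_fun setT g.
    apply/measurable_EFinP; apply: measurable_funM; last exact: measurable_indic.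
    by apply: (measurableT_comp (mb p q)); exact: measurable_snd.
  apply: (@measurable_fun_fubini_tonelli_F _ _ _ _ _ lambda _ mg) => z.
  by rewrite lee_fin !mulr_ge0 ?powR_ge0 ?indicE ?ler0n.
rewrite -ge0_integralZl//.
- by apply: eq_integral => u _; rewrite H muleCA subKr [pospow 1 _ * _]mulrC.
- apply: emeasurable_funM.
    apply/measurable_EFinP; exact: mb.
  by apply: (measurableT_comp mG); exact: measurable_funB.
- move=> u _; rewrite mule_ge0 ?integral_ge0 ?lee_fin ?mulr_ge0 ?powR_ge0 ?ler0n//.
  by move=> x _; rewrite lee_fin !mulr_ge0 ?powR_ge0 ?indicE ?ler0n.
Qed.

(** The law of [Y] has mass 1, while after the reflection [x] to [1 - x] the unnormalized density
    integrates to [1 / s]; no functional equation of [Gamma] is involved. *)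
Lemma beta_norm1 d (T : measurableType d) (R : realType) (P : probability T R)
    (Y : {RV P >-> R}) (s : R) :
  0 < s -> has_law Y (beta_law 1 s) -> Gamma (1 + s) / (Gamma 1 * Gamma s) = s.
Proof.
move=> s0 lawY; set cY := _ / _; have mb := @measurable_pospow_onem R.
have : distribution P Y setT = 1%E by rewrite probability_setT.
rewrite lawY// beta_lawE -/cY.
under eq_integral do rewrite EFinM.
rewrite ge0_integralZl; first last.
- by rewrite lee_fin divr_ge0 ?mulr_ge0 ?Gamma_ge0.
- by move=> x _; rewrite lee_fin mulr_ge0 ?pospow_ge0.
- by apply/measurable_EFinP; exact: mb.
- exact: measurableT.
rewrite ge0_integral_onem; first last.
- by move=> x; rewrite lee_fin mulr_ge0 ?pospow_ge0.
- by apply/measurable_EFinP; exact: mb.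
under eq_integral do rewrite subKr mulrC.
rewrite integral_pospow_cut// pospow_gt0E// powR1 mul1r -EFinM.
move=> -[/(canRL (mulfK _))].
by rewrite mul1r invrK; apply; rewrite invr_eq0 gt_eqF.
Qed.

(** * Conditioning on the Bernoulli variable and conclusion *)

Lemma probability_split01 d (T : measurableType d) (R : realType)
    (P : probability T R) (B : {RV P >-> R}) (S : set T) :
  P (B @^-1` ~` [set 0%R; 1%R]) = 0%E -> measurable S ->
  P S = (P (S `&` B @^-1` [set 0%R]) + P (S `&` B @^-1` [set 1%R]))%E.
Proof.
move=> PN mS.
have mB0 : measurable (B @^-1` [set 0%R]) by exact: measurable_funPTI.
have mB1 : measurable (B @^-1` [set 1%R]) by exact: measurable_funPTI.
rewrite (measureDI P mS mB0) addeC; congr (_ + _)%E.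
rewrite (measureDI P (measurableD mS mB0) mB1).
have N0 : P ((S `\` B @^-1` [set 0%R]) `\` B @^-1` [set 1%R]) = 0%E.
  apply: (@subset_measure0 _ _ _ P _ (B @^-1` ~` [set 0%R; 1%R])) => //.
  - by apply: measurableD => //; exact: measurableD.
  - by apply: measurable_funPTI; apply: measurableC; exact: measurableU.
  - by move=> t [[_ nB0] nB1] [|].
rewrite [X in (X + _)%E]N0 add0e; congr (P _).
apply/seteqP; split => t /= [St B1t]; first by case: St.
split => //; split => //; rewrite B1t.
by apply/eqP; rewrite oner_eq0.
Qed.

Theorem theorem1p2 (R : realType) (d : measure_display) (T : measurableType d)
    (P : probability T R) (a0 a1 : R) (X1 Y B1 : {RV P >-> R}) :
  0 < a0 -> 0 < a1 ->
  independent3 X1 Y B1 ->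
  has_law X1 (beta_law a1 a0) ->
  has_law Y (beta_law 1 (a0 + a1)) ->
  has_law B1 (fun A => (a0 / (a0 + a1))%:E * \d_(0%R : R) A
                       + (a1 / (a0 + a1))%:E * \d_(1%R : R) A)%E ->
  eq_in_law X1 (X1 * (1 - Y) + B1 * Y : {RV P >-> R}).
Proof.
move=> a0gt0 a1gt0 indep lawX lawY lawB A mA.
set s := a0 + a1 in lawY lawB *.
have s0 : 0 < s by rewrite addr_gt0.
set cX := Gamma (a1 + a0) / (Gamma a1 * Gamma a0).
set cY := Gamma (1 + s) / (Gamma 1 * Gamma s).
have cX0 : 0 <= cX by rewrite divr_ge0 ?mulr_ge0 ?Gamma_ge0.
have mb := @measurable_pospow_onem R.
have cYE : cY = s := beta_norm1 s0 lawY.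
pose b (x : R) : R := pospow a1 x * pospow a0 (1 - x) * \1_A x.
have mb' (s1 s2 : R) (B : set R) (mB : measurable B) :
    measurable_fun [set: R] (fun x => pospow s1 x * pospow s2 (1 - x) * \1_B x).
  by apply: measurable_funM => //; exact: measurable_indic.
have b'0 (s1 s2 : R) (B : set R) x : 0 <= pospow s1 x * pospow s2 (1 - x) * \1_B x.
  by rewrite !mulr_ge0 ?powR_ge0 ?indicE ?ler0n.
have -> : distribution P X1 A = (cX%:E * \int[lambda]_x (b x)%:E)%E.
  rewrite lawX// beta_lawE -/cX integral_mkcond -ge0_integralZl//.
  - apply: eq_integral => x _; rewrite patchE /b indicE -EFinM.
    by case: ifPn => _; rewrite ?mulr1// !mulr0.
  - by apply/measurable_EFinP; exact: mb'.
  - by move=> x _; rewrite lee_fin b'0.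
pose Z := (X1 * (1 - Y) + B1 * Y : {RV P >-> R}).
have PB0 : P (B1 @^-1` [set 0%R]) = (a0 / s)%:E.
  rewrite -[LHS]/(distribution P B1 [set 0%R]) lawB// !diracE mem_set// memNset.
    by rewrite mule1 mule0 adde0.
  by apply/eqP; rewrite oner_eq0.
have PB1 : P (B1 @^-1` [set 1%R]) = (a1 / s)%:E.
  rewrite -[LHS]/(distribution P B1 [set 1%R]) lawB// !diracE memNset//=.
    by rewrite mem_set// mule1 mule0 add0e.
  by apply/eqP; rewrite eq_sym oner_eq0.
have PBN : P (B1 @^-1` ~` [set 0%R; 1%R]) = 0%E.
  rewrite -[LHS]/(distribution P B1 _) lawB; last first.
    by apply: measurableC; exact: measurableU.
  rewrite !diracE !memNset/=; [by rewrite !mule0 adde0|by apply; right|by apply; left].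
have mB0 : measurable (B1 @^-1` [set 0%R]) by exact: measurable_funPTI.
have mB1 : measurable (B1 @^-1` [set 1%R]) by exact: measurable_funPTI.
have indep' (C : set R) : measurable C ->
    forall A B : set R, measurable A -> measurable B ->
    P (Y @^-1` A `&` X1 @^-1` B `&` B1 @^-1` C) =
    (P (Y @^-1` A) * P (X1 @^-1` B) * P (B1 @^-1` C))%E.
  by move=> mC E F mE mF; rewrite (setIC (Y @^-1` _)) indep// (muleC (P (Y @^-1` _))).
have mfst : measurable_fun [set: R * R] fst by exact: measurable_fst.
have msnd : measurable_fun [set: R * R] snd by exact: measurable_snd.
(* The points are pairs [(y, x)]; [M0] and [M1] describe the event that the right-hand side falls in
   [A] when [B1] is 0 and 1 respectively. *)
pose M0 : set (R * R) := (fun z => z.2 * (1 - z.1)) @^-1` A.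
pose M1 : set (R * R) := (fun z => z.2 * (1 - z.1) + z.1) @^-1` A.
have mM0 : measurable M0.
  rewrite -[M0]setTI; apply: (_ : measurable_fun setT _) => //.
  by apply: measurable_funM => //; exact: measurable_funB.
have mM1 : measurable M1.
  rewrite -[M1]setTI; apply: (_ : measurable_fun setT _) => //.
  apply: measurable_funD => //; apply: measurable_funM => //.
  exact: measurable_funB.
rewrite [RHS]/distribution /pushforward.
rewrite (probability_split01 PBN); last exact: measurable_funPTI.
have Z0E t : B1 t = 0 -> Z t = X1 t * (1 - Y t).
  by move=> B0; rewrite -[Z t]/(X1 t * (1 - Y t) + B1 t * Y t) B0 mul0r addr0.
have Z1E t : B1 t = 1 -> Z t = X1 t * (1 - Y t) + Y t.
  by move=> B0; rewrite -[Z t]/(X1 t * (1 - Y t) + B1 t * Y t) B0 mul1r.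
have -> : Z @^-1` A `&` B1 @^-1` [set 0%R] =
    (fun t => (Y t, X1 t)) @^-1` M0 `&` B1 @^-1` [set 0%R].
  apply/seteqP; split => t [h B0]; split => //.
    exact: (eq_ind _ A h _ (Z0E t B0)).
  exact: (eq_ind _ A h _ (esym (Z0E t B0))).
have -> : Z @^-1` A `&` B1 @^-1` [set 1%R] =
    (fun t => (Y t, X1 t)) @^-1` M1 `&` B1 @^-1` [set 1%R].
  apply/seteqP; split => t [h B0]; split => //.
    exact: (eq_ind _ A h _ (Z1E t B0)).
  exact: (eq_ind _ A h _ (esym (Z1E t B0))).
rewrite !(@pair_law _ _ _ _ Y X1)//; try exact: indep'.
rewrite (pair_beta_integral mM0 lawX lawY) (pair_beta_integral mM1 lawX lawY).
rewrite -/cX -/cY PB0 PB1 cYE.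
pose f0 (t : R) := pospow a1 t * pospow (a0 + 1) (1 - t) * \1_A t.
pose f1 (t : R) := pospow (a1 + 1) t * pospow a0 (1 - t) * \1_A t.
have I0 : (\int[lambda]_u ((pospow s u * pospow 1 (1 - u))%:E *
    \int[lambda]_x (pospow a1 x * pospow a0 (1 - x) * \1_M0 (1 - u, x))%:E) =
    \int[lambda]_t (a0^-1 * f0 t)%:E)%E.
  rewrite -(integral_pospow_mul a1 a0gt0 mA) /s [a0 + a1]addrC.
  apply: eq_integral => u _; congr (_ * _)%E; apply: eq_integral => x _.
  have -> // : \1_M0 (1 - u, x) = \1_A (x * u) :> R.
  by rewrite -[in RHS](subKr 1 u).
(* When [B1 = 1], replacing [x] by [1 - x] turns the value into [(1 - x) u + (1 - u) = 1 - x u]. The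
   event becomes that [x u] lies in [A'], and [a0] and [a1] trade places. *)
pose A' : set R := (fun t => 1 - t) @^-1` A.
have mA' : measurable A'.
  rewrite -[A']setTI; apply: (_ : measurable_fun setT _) => //.
  exact: measurable_funB.
have I1 : (\int[lambda]_u ((pospow s u * pospow 1 (1 - u))%:E *
    \int[lambda]_x (pospow a1 x * pospow a0 (1 - x) * \1_M1 (1 - u, x))%:E) =
    \int[lambda]_t (a1^-1 * f1 t)%:E)%E.
  transitivity (\int[lambda]_t
      (a1^-1 * (pospow a0 t * pospow (a1 + 1) (1 - t) * \1_A' t))%:E)%E.
    rewrite -(integral_pospow_mul a0 a1gt0 mA') -/s.
    apply: eq_integral => u _; congr (_ * _)%E; rewrite ge0_integral_onem; first last.
    - by move=> x; rewrite lee_fin !mulr_ge0 ?powR_ge0 ?indicE ?ler0n.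
    - apply/measurable_EFinP; apply: measurable_funM; first exact: mb.
      by apply: (measurableT_comp (measurable_indic mM1)); exact: measurable_pair1.
    apply: eq_integral => x _; rewrite subKr [pospow a1 _ * _]mulrC.
    have -> // : \1_M1 (1 - u, 1 - x) = \1_A' (x * u) :> R.
    have E : (1 - x) * (1 - (1 - u)) + (1 - u) = 1 - x * u by ring.
    by rewrite -[LHS]/(\1_A ((1 - x) * (1 - (1 - u)) + (1 - u))) E.
  rewrite [RHS]ge0_integral_onem; first last.
  - by move=> x; rewrite lee_fin mulr_ge0 ?invr_ge0 ?b'0 ?ltW.
  - by apply/measurable_EFinP; apply: measurable_funM => //; exact: mb'.
  by apply: eq_integral => t _; rewrite /f1 subKr [pospow a0 t * _]mulrC.
have f00 t : 0 <= f0 t by exact: b'0.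
have f10 t : 0 <= f1 t by exact: b'0.
have mf0 : measurable_fun [set: R] f0 by exact: mb'.
have mf1 : measurable_fun [set: R] f1 by exact: mb'.
(* The Bernoulli weight [a / s] cancels both the constant [s] of the law of [Y] and the factor
   [a^-1] left by integrating over [u]. *)
have scale (a : R) (f : R -> R) :
    0 < a -> measurable_fun [set: R] f -> (forall t, 0 <= f t) ->
    ((a / s)%:E * ((s * cX)%:E * \int[lambda]_t (a^-1 * f t)%:E) =
     cX%:E * \int[lambda]_t (f t)%:E)%E.
  move=> a_gt0 mf f_ge0.
  under eq_integral do rewrite EFinM.
  rewrite ge0_integralZl//; first last.
  - by rewrite lee_fin invr_ge0 ltW.
  - by move=> x _; rewrite lee_fin.
  - exact/measurable_EFinP.
  rewrite !muleA -!EFinM; congr (_%:E * _)%E; field.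
  by rewrite !gt_eqF.
rewrite I0 I1 !scale// -ge0_muleDr; first last.
- by apply: integral_ge0 => t _; rewrite lee_fin.
- by apply: integral_ge0 => t _; rewrite lee_fin.
congr (_ * _)%E; rewrite -ge0_integralD//.
- apply: eq_integral => t _; rewrite -EFinD; congr EFin.
  (* [f0] is [1 - t] times [b] and [f1] is [t] times [b], so they add up to [b]. *)
  by rewrite /b /f0 /f1 !pospow_succ; ring.
- by move=> t _; rewrite lee_fin.
- exact/measurable_EFinP.
- by move=> t _; rewrite lee_fin.
- exact/measurable_EFinP.
Qed.
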